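(* For all integers $n_1,n_2,n_3\ge 0$, $$\mathcal{L}_q\bigl(L_{n_1}(x;q)L_{n_2}(x;q)L_{n_3}(x;q)\bigr)=\sum_{s}\frac{n_1!_q\,n_2!_q\,n_3!_q\,s!_q\,y^s}{(n_1+n_2+n_3-2s)!_q\,(s-n_3)!_q\,(s-n_2)!_q\,(s-n_1)!_q}\ \sum_{k}\begin{bmatrix}n_1+n_2+n_3-2s\\ k\end{bmatrix}_q y^{k}\,q^{\binom{k+1}{2}+\binom{n_1+n_2+n_3-2s-k}{2}},$$ where $s$ runs over the integers with $\max(n_1,n_2,n_3)\le s$ and $2s\le n_1+n_2+n_3$, and $k$ runs over $0\le k\le n_1+n_2+n_3-2s$.
   Context: Notation: $[n]_q=\frac{1-q^n}{1-q}$, $n!_q=\prod_{j=1}^n[j]_q$, $\begin{bmatrix}n\\k\end{bmatrix}_q=\frac{n!_q}{k!_q(n-k)!_q}$. The Al-Salam-Chihara polynomials $Q_n(x;\alpha,\beta|q)$ are defined by $Q_{-1}=0$, $Q_0=1$, $Q_{n+1}(x)=(2x-(\alpha+\beta)q^n)Q_n(x)-(1-q^n)(1-\alpha\beta q^{n-1})Q_{n-1}(x)$. The $q$-Laguerre polynomials (depending on a parameter $y$) are $$L_n(x;q)=\left(\frac{\sqrt y}{q-1}\right)^nQ_n\left(\frac{(q-1)x+y+1}{2\sqrt y};\frac1{\sqrt y},\sqrt y\,q\,\Big|\,q\right),$$ and they satisfy $L_{-1}(x;q)=0$, $L_0(x;q)=1$, $L_{n+1}(x;q)=(x-y[n+1]_q-[n]_q)L_n(x;q)-y[n]_q^2L_{n-1}(x;q)$.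 $S_n$ is the set of permutations of $\{1,\dots,n\}$. For $\sigma\in S_n$, $\mathrm{wex}(\sigma)=\#\{i: 1\le i\le n,\ i\le\sigma(i)\}$ and $$\mathrm{cr}(\sigma)=\sum_{i=1}^n\#\{j: j<i\le\sigma(j)<\sigma(i)\}+\sum_{i=1}^n\#\{j: j>i>\sigma(j)>\sigma(i)\}.$$ $\mathcal{L}_q$ is the linear functional on polynomials in $x$ with $\mathcal{L}_q(x^n)=\sum_{\sigma\in S_n}y^{\mathrm{wex}(\sigma)}q^{\mathrm{cr}(\sigma)}$ for all $n\ge 0$ (so $\mathcal{L}_q(1)=1$). *)

(* Defs.v *)
From HB Require Import structures.
From mathcomp Require Import all_boot all_order all_algebra all_fingroup.

Set Implicit Arguments.
Unset Strict Implicit.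
Unset Printing Implicit Defensive.

Import GRing.Theory.
Local Open Scope ring_scope.

(* The parameters q, y and a chosen square root ry of y are elements of an
   arbitrary field; taking F to be a field of rational functions in ry and q
   gives the case where they are indeterminates. *)

Definition qint (F : fieldType) (q : F) (n : nat) : F :=
  (1 - q ^+ n) / (1 - q).

Definition qfact (F : fieldType) (q : F) (n : nat) : F :=
  \prod_(1 <= j < n.+1) qint q j.

(* Only meaningful for k <= n, because of the truncated subtraction. *)
Definition qbinom (F : fieldType) (q : F) (n k : nat) : F :=
  qfact q n / (qfact q k * qfact q (n - k)).

(* The inner match encodes the convention that the polynomial of index -1
   is 0; for m = k.+1 the exponent k is m - 1. *)
Fixpoint al_salam_chihara (F : fieldType) (a b q : F) (n : nat) : {poly F} :=
  match n with
  | 0 => 1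
  | m.+1 =>
      (2%:R *: 'X - ((a + b) * q ^+ m)%:P) * al_salam_chihara a b q m
      - match m with
        | 0 => 0
        | k.+1 => ((1 - q ^+ m) * (1 - a * b * q ^+ k))
                    *: al_salam_chihara a b q k
        end
  end.

(* Meant for ry ^+ 2 = y. *)
Definition qlaguerre (F : fieldType) (y ry q : F) (n : nat) : {poly F} :=
  (ry / (q - 1)) ^+ n *:
    (al_salam_chihara (1 / ry) (ry * q) q n
       \Po ((2%:R * ry)^-1 *: ((q - 1) *: 'X + (y + 1)%:P))).

(* 'S_n permutes {0, ..., n-1} rather than {1, ..., n}; the two statistics
   below only involve comparisons, so the shift does not affect them. *)
Definition wex (n : nat) (s : 'S_n) : nat := #|[set i : 'I_n | (i <= s i)%N]|.

Definition cr (n : nat) (s : 'S_n) : nat :=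
  (\sum_(i < n) #|[set j : 'I_n | [&& j < i, i <= s j & s j < s i]]|
   + \sum_(i < n) #|[set j : 'I_n | [&& j > i, i > s j & s j > s i]]|)%N.

Definition lag_moment (F : fieldType) (y q : F) (n : nat) : F :=
  \sum_(s : 'S_n) y ^+ wex s * q ^+ cr s.

Definition lag_functional (F : fieldType) (y q : F) (p : {poly F}) : F :=
  \sum_(i < size p) p`_i * lag_moment y q i.

Lemma lag_functional_wide (F : fieldType) (y q : F) (p : {poly F}) m :
  (size p <= m)%N ->
  lag_functional y q p = \sum_(i < m) p`_i * lag_moment y q i.
Proof.
move=> le_pm; rewrite /lag_functional.
rewrite (big_ord_widen m (fun i => p`_i * lag_moment y q i) le_pm).
rewrite big_mkcond /=; apply: eq_bigr => i _.
by case: ltnP => // le_pi; rewrite nth_default ?mul0r.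
Qed.

Lemma lag_functional_is_scalar (F : fieldType) (y q : F) :
  scalar (lag_functional y q).
Proof.
move=> c p r; set m := maxn (size p) (size r).
have le_m : (size (c *: p + r)%R <= m)%N.
  rewrite (leq_trans (size_polyD _ _)) // geq_max leq_max leq_maxr andbT.
  by rewrite size_scale_leq.
rewrite (lag_functional_wide _ _ le_m).
rewrite (lag_functional_wide _ _ (leq_maxl _ _ : size p <= m)%N).
rewrite (lag_functional_wide _ _ (leq_maxr _ _ : size r <= m)%N).
rewrite mulr_sumr -big_split /=; apply: eq_bigr => i _.
by rewrite coefD coefZ mulrDl mulrA.
Qed.

HB.instance Definition _ (F : fieldType) (y q : F) :=
  GRing.isLinear.Build F {poly F} F *%R (lag_functional y q)
    (lag_functional_is_scalar y q).

Lemma lag_functionalXn (F : fieldType) (y q : F) n :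
  lag_functional y q 'X^n = lag_moment y q n.
Proof.
rewrite /lag_functional size_polyXn big_ord_recr /= coefXn eqxx mul1r.
rewrite big1 ?add0r // => i _.
by rewrite coefXn ltn_eqF ?mul0r.
Qed.

(* Main.v *)
(* Moments: scan a permutation from left to right, first the position k and
   then the value k.  A closing arc that ends at the v-th of the l candidates
   creates as many crossings as there are candidates above v, so the choices
   contribute [l]_q, and the sum over all completions depends only on the
   number of open arcs.  This yields the Motzkin-path recursion whose
   coefficients are those of the three-term recurrence of L_n; hence L_q(L_h)
   vanishes for h > 0.

   Product: expanding x L_a L_b L_c by the recurrence in a and in b gives a
   relation that determines all values from those at a = 0.  The right-hand
   side satisfies the same relation: with H_m the inner sum, the recurrence
   H_(m+1) = q^m ((1 + yq) H_m + y (1 - q^m) H_(m-1)) makes the difference of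
   the two expansions telescope in s. *)
Require Import Defs.
From mathcomp Require Import all_boot all_order all_algebra all_fingroup.
From mathcomp Require Import ring zify.

Set Implicit Arguments.
Unset Strict Implicit.
Unset Printing Implicit Defensive.

Import GRing.Theory.
Local Open Scope ring_scope.

(** * q-integers and q-factorials *)

Section QNumbers.

Variables (F : fieldType) (y q : F).
Hypothesis hq : forall j : nat, (0 < j)%N -> q ^+ j != 1.

Lemma subq_neq0 : 1 - q != 0.
Proof. by rewrite subr_eq0 eq_sym -[q]expr1 hq. Qed.

Lemma qint0 : qint q 0 = 0.
Proof. by rewrite /qint expr0 subrr mul0r. Qed.

Lemma qint_neq0 n : qint q n.+1 != 0.
Proof.
by rewrite /qint mulf_eq0 invr_eq0 negb_or subq_neq0 subr_eq0 eq_sym hq.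
Qed.

Lemma qintD m n : qint q (m + n) = qint q m + q ^+ m * qint q n.
Proof. by rewrite /qint exprD; field; exact: subq_neq0. Qed.

Lemma qint1 : qint q 1 = 1.
Proof. by rewrite /qint expr1 divff // subq_neq0. Qed.

Lemma qint_sub_mul n : (1 - q) * qint q n = 1 - q ^+ n.
Proof. by rewrite /qint; field; exact: subq_neq0. Qed.

Lemma qfact0 : qfact q 0 = 1.
Proof. by rewrite /qfact big_geq. Qed.

Lemma qfactS n : qfact q n.+1 = qfact q n * qint q n.+1.
Proof. by rewrite /qfact big_nat_recr. Qed.

Lemma qfact_neq0 n : qfact q n != 0.
Proof.
by elim: n => [|n IH]; rewrite ?qfact0 ?oner_eq0 // qfactS mulf_neq0 ?qint_neq0.
Qed.

(* 1 / [s - a]!, extended by 0 to the range s < a. *)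
Definition qfact_inv (s a : nat) : F :=
  if (a <= s)%N then (qfact q (s - a))^-1 else 0.

Lemma qfact_invSS s a : qfact_inv s.+1 a.+1 = qfact_inv s a.
Proof. by rewrite /qfact_inv ltnS subSS. Qed.

Lemma qfact_invS s a : qfact_inv s a.+1 = qint q (s - a) * qfact_inv s a.
Proof.
rewrite /qfact_inv; case: (ltngtP a s) => [lt_as|_|->]; rewrite ?mulr0 //.
  have -> : (s - a = (s - a.+1).+1)%N by lia.
  by rewrite qfactS invfM mulrCA divff ?mulr1 ?qint_neq0.
by rewrite subnn qint0 mul0r.
Qed.

(** * The inner sum as a convolution *)

Definition szego_l k := y ^+ k * q ^+ 'C(k.+1, 2) / qfact q k.
(** Coefficients of the q-exponential (-(1 - q)t; q)_infinity in t; those of [szego_l] come from yqt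
    in place of t. *)
Definition szego_r j := q ^+ 'C(j, 2) / qfact q j.

Lemma szego_lS k : qint q k.+1 * szego_l k.+1 = y * q * q ^+ k * szego_l k.
Proof.
rewrite /szego_l qfactS binS bin1 exprD !exprS.
by field; rewrite qint_neq0 qfact_neq0.
Qed.

Lemma szego_rS j : qint q j.+1 * szego_r j.+1 = q ^+ j * szego_r j.
Proof.
rewrite /szego_r qfactS binS bin1 exprD.
by field; rewrite qint_neq0 qfact_neq0.
Qed.

(* The inner sum of the theorem divided by [m]!, which is, up to a power of q,
   the Rogers-Szego polynomial h_m(yq | 1/q). *)
Definition szego m := \sum_(k < m.+1) szego_l k * szego_r (m - k).

Lemma szego0 : szego 0 = 1.
Proof.
by rewrite /szego big_ord1 /szego_l /szego_r qfact0 !expr0 !divr1 !mul1r.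
Qed.

Lemma szego_qbinom m :
  \sum_(0 <= k < m.+1)
     qbinom q m k * y ^+ k * q ^+ ('C(k.+1, 2) + 'C(m - k, 2))
  = qfact q m * szego m.
Proof.
rewrite big_mkord /szego mulr_sumr; apply: eq_bigr => k _.
rewrite /qbinom /szego_l /szego_r exprD.
by field; rewrite !qfact_neq0.
Qed.

Lemma szego_shift_r m :
  \sum_(k < m.+1) q ^+ k * qint q (m - k) * (szego_l k * szego_r (m - k))
  = if m is m'.+1 then q ^+ m' * szego m' else 0.
Proof.
case: m => [|m]; first by rewrite big_ord1 qint0 mulr0 mul0r.
rewrite big_ord_recr /= subnn qint0 mulr0 mul0r addr0 /szego mulr_sumr.
apply: eq_bigr => k _.
have ltk := ltn_ord k; rewrite subSn; last by lia.
have -> : q ^+ m = q ^+ k * q ^+ (m - k) by rewrite -exprD subnKC.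
transitivity (q ^+ k * szego_l k *
   (qint q (m - k).+1 * szego_r (m - k).+1)); first by ring.
by rewrite szego_rS; ring.
Qed.

Lemma szego_shift_l m :
  \sum_(k < m.+2) qint q k * (szego_l k * szego_r (m.+1 - k))
  = y * q * \sum_(k < m.+1) q ^+ k * (szego_l k * szego_r (m - k)).
Proof.
rewrite big_ord_recl /= qint0 mul0r add0r mulr_sumr; apply: eq_bigr => k _.
by rewrite /= /bump /= add1n subSS mulrA szego_lS; ring.
Qed.

(** Splitting [m+1] = [k] + q^k [m+1-k] under the sum lets each part shift an index. The left shift
    leaves weights q^k, and q^k - q^m = (1 - q) q^k [m-k] brings in the right shift once more. *)
Lemma szegoS m :
  qint q m.+1 * szego m.+1 =
  q ^+ m * ((1 + y * q) * szego m
            + y * (1 - q) * (if m is m'.+1 then szego m' else 0)).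
Proof.
have -> : qint q m.+1 * szego m.+1 =
   \sum_(k < m.+2) qint q k * (szego_l k * szego_r (m.+1 - k))
   + \sum_(k < m.+2) q ^+ k * qint q (m.+1 - k)
       * (szego_l k * szego_r (m.+1 - k)).
  rewrite -big_split mulr_sumr; apply: eq_bigr => k _ /=.
  by rewrite -mulrDl -qintD subnKC // -ltnS.
rewrite szego_shift_r szego_shift_l.
have -> : \sum_(k < m.+1) q ^+ k * (szego_l k * szego_r (m - k)) =
   q ^+ m * szego m + (1 - q) * \sum_(k < m.+1) q ^+ k * qint q (m - k)
       * (szego_l k * szego_r (m - k)).
  rewrite /szego !mulr_sumr -big_split; apply: eq_bigr => k _ /=.
  have -> : q ^+ m = q ^+ k * q ^+ (m - k) by rewrite -exprD subnKC // -ltnS.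
  transitivity ((q ^+ k * q ^+ (m - k) + q ^+ k * ((1 - q) * qint q (m - k)))
       * (szego_l k * szego_r (m - k))); last by ring.
  by rewrite qint_sub_mul; ring.
by rewrite szego_shift_r; case: m => [|m]; rewrite ?exprS ?expr0; ring.
Qed.

(** * The right-hand side and its symmetries *)

Definition szego_sub (n k : nat) : F := if (k <= n)%N then szego (n - k) else 0.

(** [N] stands for a + b + c. As a separate argument it allows [N.-1] beside [a.-1] even at a = 0,
    where the coefficient [a] vanishes. *)
Definition linz_term (N s a b c : nat) : F :=
  qfact q s * y ^+ s * szego_sub N (2 * s)
  * (qfact_inv s a * qfact_inv s b * qfact_inv s c).

Definition linz (a b c : nat) : F :=
  qfact q a * qfact q b * qfact q c *
  \sum_(0 <= s < (a + b + c).+1) linz_term (a + b + c) s a b c.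

Lemma linz_termC N s a b c : linz_term N s a b c = linz_term N s b a c.
Proof. by rewrite /linz_term [qfact_inv s a * _]mulrC. Qed.

Lemma linzCA a b c : linz a b c = linz b a c.
Proof.
rewrite /linz [qfact q a * _]mulrC (addnC a b).
by congr (_ * _); apply: eq_bigr => s _; rewrite linz_termC.
Qed.

Lemma linzAC a b c : linz a b c = linz a c b.
Proof.
rewrite /linz -!(mulrAC _ (qfact q c)) addnAC.
congr (_ * _); apply: eq_bigr => s _.
by rewrite /linz_term -!mulrA [qfact_inv s c * _]mulrC.
Qed.

Lemma linz_wide a b c M : (a + b + c < M)%N ->
  linz a b c = qfact q a * qfact q b * qfact q c *
    \sum_(0 <= s < M) linz_term (a + b + c) s a b c.
Proof.
move=> ltM; rewrite /linz (big_cat_nat (leq0n _) ltM) /=.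
rewrite [X in _ * (_ + X)]big_nat [X in _ * (_ + X)]big1 ?addr0 //.
move=> s /andP[les _]; rewrite /linz_term /szego_sub ifF ?mulr0 ?mul0r //.
lia.
Qed.

Definition lag_diag n : F := y * qint q n.+1 + qint q n.

(** Since (N - 1) - 2s = (N + 1) - 2(s + 1), a lowered term at s involves the same H as a raised
    term at s + 1; the form on the right exposes their common factor. *)
Lemma linz_term_pred N s a b c : (a <= N)%N ->
  qint q a * linz_term N.-1 s a.-1 b c =
  qfact q s * y ^+ s * szego_sub N.+1 (2 * s.+1)
  * (qfact_inv s.+1 a * qfact_inv s.+1 b * qfact_inv s.+1 c)
  * (qint q a * qint q (s.+1 - b) * qint q (s.+1 - c)).
Proof.
case: a => [|a]; first by rewrite qint0 !mul0r mulr0.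
case: N => // N _; rewrite /linz_term -[qfact_inv s a]qfact_invSS.
rewrite -[qfact_inv s b]qfact_invSS -[qfact_inv s c]qfact_invSS.
rewrite !(qfact_invS s.+1 b, qfact_invS s.+1 c) /szego_sub mulnS /=.
rewrite !ltnS !subSS.
by case: ifP => _; ring.
Qed.

(** * Recurrence of the right-hand side by telescoping in s *)

Section Step.

Variables a b c : nat.
Let N := (a + b + c)%N.

Definition step_prod s := qfact_inv s a * qfact_inv s b * qfact_inv s c.

(* The middle terms of the two expansions differ by
   [(1 + yq) ([a] - [b]) H_m] with [m = N - 2s].  The recurrence of H turns it
   into [step_u - step_v], where q^m has been cancelled from [a] - [b] since q
   may be 0. *)
Definition step_u s :=
  qfact q s * y ^+ s * step_prod s *
  (qint q (a - (N - 2 * s)) - qint q (b - (N - 2 * s))) *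
  qint q (N.+1 - 2 * s) * szego_sub N.+1 (2 * s).

Definition step_v s :=
  qfact q s * y ^+ s.+1 * step_prod s *
  ((1 - q) * (qint q a - qint q b)) * szego_sub N (2 * s).+1.

Lemma step_prod_eq0 s :
  ~~ [&& a <= s, b <= s & c <= s]%N -> step_prod s = 0.
Proof.
rewrite /step_prod /qfact_inv.
by do 3?case: leqP => _ //=; rewrite ?(mul0r, mulr0).
Qed.

Lemma linz_termE n s :
  linz_term n s a b c =
  qfact q s * y ^+ s * szego_sub n (2 * s) * step_prod s.
Proof. by []. Qed.

Lemma qint_sub i j m : (m <= i)%N -> (m <= j)%N ->
  qint q i - qint q j = q ^+ m * (qint q (i - m) - qint q (j - m)).
Proof.
move=> lei lej; rewrite -{1}(subnKC lei) -{1}(subnKC lej) !qintD.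
by ring.
Qed.

(** Where the term is nonzero, a, b, c <= s forces m = N - 2s <= a, b. Hence [a] - [b] has the
    factor q^m that the recurrence of H requires. *)
Lemma step_diag s :
  (lag_diag a - lag_diag b) * linz_term N s a b c = step_u s - step_v s.
Proof.
rewrite linz_termE /step_u /step_v.
have [/and3P[las lbs lcs]|/step_prod_eq0->] :=
  boolP [&& a <= s, b <= s & c <= s]%N; last by rewrite !(mulr0, mul0r) subrr.
have -> : lag_diag a - lag_diag b = (1 + y * q) * (qint q a - qint q b).
  by rewrite /lag_diag -(add1n a) -(add1n b) !qintD qint1 expr1; ring.
rewrite /szego_sub; case: (leqP (2 * s) N) => [le2|lt2]; last first.
  rewrite mulr0 mul0r mulr0 [(2 * s < N)%N]ltnNge (ltnW lt2) /= mulr0 subr0.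
  (* At 2s = N + 1 the factor H_0 of [step_u] is not zero; [N + 1 - 2s] = 0 is what makes the
     product vanish. *)
  symmetry; case: leqP => [?|_]; rewrite ?mulr0 //.
  by rewrite (_ : N.+1 - 2 * s = 0)%N ?qint0 ?mulr0 ?mul0r //; lia.
rewrite (leqW le2) subSn //.
set m := (N - 2 * s)%N.
have -> : (N - (2 * s).+1 = m.-1)%N by rewrite subnS.
rewrite -[_ * qint q m.+1 * _]mulrA szegoS.
rewrite (_ : (2 * s < N)%N = (0 < m)%N); last by rewrite subn_gt0.
rewrite (@qint_sub a b m) /m; try by rewrite /N; lia.
rewrite -/m exprS.
case: m => [|m] /=; ring.
Qed.

(** Raised terms at s + 1 meet lowered terms at s, all multiples of [K]; what remains is an identity
    between q-integers. *)
Lemma step_telescope s :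
  qint q a.+1 * linz_term N.+1 s.+1 a.+1 b c
  - qint q b.+1 * linz_term N.+1 s.+1 a b.+1 c
  + step_u s.+1
  + (y * qint q a * linz_term N.-1 s a.-1 b c
  - y * qint q b * linz_term N.-1 s a b.-1 c - step_v s) = 0.
Proof.
set K := qfact q s * y ^+ s.+1 * step_prod s.+1 * szego_sub N.+1 (2 * s.+1).
transitivity (K * (qint q s.+1 *
  (qint q a.+1 * qint q (s.+1 - a) - qint q b.+1 * qint q (s.+1 - b)
   + (qint q (a - (N - 2 * s.+1)) - qint q (b - (N - 2 * s.+1))) *
     qint q (N.+1 - 2 * s.+1))
  + qint q a * qint q (s.+1 - b) * qint q (s.+1 - c)
  - qint q b * qint q (s.+1 - a) * qint q (s.+1 - c)
  - (1 - q) * (qint q a - qint q b) * qint q (s.+1 - a) * qint q (s.+1 - b)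
    * qint q (s.+1 - c))).
  have eA : y * qint q a * linz_term N.-1 s a.-1 b c =
     K * (qint q a * qint q (s.+1 - b) * qint q (s.+1 - c)).
    rewrite -mulrA linz_term_pred /K /step_prod ?exprS; first by ring.
    by rewrite /N; lia.
  have eB : y * qint q b * linz_term N.-1 s a b.-1 c =
     K * (qint q b * qint q (s.+1 - a) * qint q (s.+1 - c)).
    rewrite linz_termC -mulrA linz_term_pred /K /step_prod ?exprS;
      first by ring.
    by rewrite /N; lia.
  have eV : step_v s = K * ((1 - q) * (qint q a - qint q b)
     * qint q (s.+1 - a) * qint q (s.+1 - b) * qint q (s.+1 - c)).
    rewrite /step_v /K /step_prod -[qfact_inv s a]qfact_invSS.
    rewrite -[qfact_inv s b]qfact_invSS -[qfact_inv s c]qfact_invSS.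
    rewrite !qfact_invS /szego_sub mulnS !ltnS !subSS.
    by case: ifP => _; ring.
  rewrite eA eB eV /step_u /linz_term /K /step_prod !qfact_invS qfactS.
  by ring.
(* The q-integer identity relies on exact subtractions, so it is proved only in the range of s + 1;
   elsewhere [K] vanishes. *)
suff: K = 0 \/ [&& a <= s.+1, b <= s.+1 & c <= s.+1]%N /\ (2 * s.+1 <= N.+1)%N.
  case=> [->|[/and3P[]]]; first by rewrite mul0r.
  move=> las lbs lcs; rewrite /N => lN.
  apply/eqP; rewrite mulf_eq0; apply/orP; right; apply/eqP.
  move: (s.+1) las lbs lcs lN => {K}s las lbs lcs lN.
  (* For m = N - 2s the constraints are solved by a = m + be + ga, b = m + al + ga, s = m + al + be
     + ga. The claim becomes a rational identity in q and the powers of q with free exponents. *)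
  move: (subnKC las) (subnKC lbs) (subnKC lcs) (subnKC lN).
  set al := (s - a)%N; set be := (s - b)%N; set ga := (s - c)%N.
  case em: (_.+1 - 2 * s)%N => [|m] ea eb ec eN.
    (* a + b + c + 1 = 2s: solving for a would give be + ga - 1, so a positive
       variable has to be decremented. *)
    have -> : (a + b + c - 2 * s = 0)%N by lia.
    rewrite !subn0 qint0 mulr0 addr0.
    case: (posnP ga) => [g0|]; last first.
      case: ga ec => // g ec _.
      have -> : a = (be + g)%N by lia.
      have -> : b = (al + g)%N by lia.
      have -> : s = (al + be + g)%N by lia.
      rewrite /qint ![q ^+ _.+1]exprS !exprD.
      by field; exact: subq_neq0.
    case: al ea => [|al] ea; first by lia.
    case: be eb => [|be] eb; first by lia.
    have -> : a = be by lia.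
    have -> : b = al by lia.
    have -> : s = (al + be).+1%N by lia.
    rewrite g0 /qint ![q ^+ _.+1]exprS !exprD.
    by field; exact: subq_neq0.
  have -> : (a + b + c - 2 * s = m)%N by lia.
  have -> : (a - m = be + ga)%N by lia.
  have -> : (b - m = al + ga)%N by lia.
  have -> : a = (m + be + ga)%N by lia.
  have -> : b = (m + al + ga)%N by lia.
  have -> : s = (m + al + be + ga)%N by lia.
  rewrite /qint ![q ^+ _.+1]exprS !exprD.
  by field; exact: subq_neq0.
have [lm|/step_prod_eq0 K0] :=
  boolP [&& a <= s.+1, b <= s.+1 & c <= s.+1]%N; last first.
  by left; rewrite /K K0 mulr0 mul0r.
case: (leqP (2 * s.+1) N.+1) => [//|lt2]; first by right.
by left; rewrite /K /szego_sub leqNgt lt2 mulr0.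
Qed.

Lemma step_init :
  qint q a.+1 * linz_term N.+1 0 a.+1 b c
  - qint q b.+1 * linz_term N.+1 0 a b.+1 c + step_u 0 = 0.
Proof.
have z n : qfact_inv 0 n.+1 = 0 by [].
rewrite /linz_term /step_u !z !(mulr0, mul0r) subr0 add0r.
have [/and3P[]|/step_prod_eq0->] :=
  boolP [&& a <= 0, b <= 0 & c <= 0]%N; last by rewrite !(mulr0, mul0r).
rewrite !leqn0 => /eqP-> /eqP-> _.
by rewrite !sub0n subrr !(mulr0, mul0r).
Qed.

(** Both sides play the role of the functional at x L_a L_b L_c. After the common factorials are
    removed, the difference is a sum over s that telescopes. *)
Lemma linz_rec :
  linz a.+1 b c + lag_diag a * linz a b c
    + y * qint q a ^+ 2 * linz a.-1 b c =
  linz a b.+1 c + lag_diag b * linz a b c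
    + y * qint q b ^+ 2 * linz a b.-1 c.
Proof.
apply/eqP; rewrite -subr_eq0; apply/eqP.
have pred n : qint q n ^+ 2 * qfact q n.-1 = qint q n * qfact q n.
  by case: n => [|n]; rewrite ?qint0 ?expr0n ?mul0r //= qfactS; ring.
have wide_a : y * qint q a ^+ 2 * linz a.-1 b c =
    qfact q a * qfact q b * qfact q c *
    \sum_(0 <= s < N.+2) y * qint q a * linz_term N.-1 s a.-1 b c.
  rewrite -mulr_sumr (@linz_wide _ _ _ N.+2); last by rewrite /N; lia.
  transitivity (y * (qint q a ^+ 2 * qfact q a.-1) * qfact q b * qfact q c *
     \sum_(0 <= s < N.+2) linz_term (a.-1 + b + c) s a.-1 b c); first by ring.
  rewrite pred /N; case: (a) => [|a'] /=; first by rewrite qint0; ring.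
  by rewrite !addSn /=; ring.
have wide_b : y * qint q b ^+ 2 * linz a b.-1 c =
    qfact q a * qfact q b * qfact q c *
    \sum_(0 <= s < N.+2) y * qint q b * linz_term N.-1 s a b.-1 c.
  rewrite -mulr_sumr (@linz_wide _ _ _ N.+2); last by rewrite /N; lia.
  transitivity (y * (qint q b ^+ 2 * qfact q b.-1) * qfact q a * qfact q c *
     \sum_(0 <= s < N.+2) linz_term (a + b.-1 + c) s a b.-1 c); first by ring.
  rewrite pred /N; case: (b) => [|b'] /=; first by rewrite qint0; ring.
  by rewrite addnS !addSn /=; ring.
rewrite wide_a wide_b.
rewrite !(@linz_wide _ _ _ N.+2) /N; try by lia.
rewrite !qfactS addnS !addSn -/N.
set f := qfact q a * qfact q b * qfact q c.
transitivity (f * (\sum_(0 <= s < N.+2)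
    (qint q a.+1 * linz_term N.+1 s a.+1 b c
     - qint q b.+1 * linz_term N.+1 s a b.+1 c + step_u s)
  + \sum_(0 <= s < N.+2)
    (y * qint q a * linz_term N.-1 s a.-1 b c
     - y * qint q b * linz_term N.-1 s a b.-1 c - step_v s))).
  have -> : \sum_(0 <= s < N.+2)
    (qint q a.+1 * linz_term N.+1 s a.+1 b c
     - qint q b.+1 * linz_term N.+1 s a b.+1 c + step_u s)
    = qint q a.+1 * (\sum_(0 <= s < N.+2) linz_term N.+1 s a.+1 b c)
     - qint q b.+1 * (\sum_(0 <= s < N.+2) linz_term N.+1 s a b.+1 c)
     + \sum_(0 <= s < N.+2) step_u s.
    by rewrite big_split sumrB -!mulr_sumr.
  rewrite !sumrB.
  have eD : (lag_diag a - lag_diag b) *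
      \sum_(0 <= s < N.+2) linz_term N s a b c =
    \sum_(0 <= s < N.+2) step_u s - \sum_(0 <= s < N.+2) step_v s.
    by rewrite mulr_sumr -sumrB; apply: eq_bigr => s _; exact: step_diag.
  have -> : \sum_(0 <= s < N.+2) step_u s =
    (lag_diag a - lag_diag b) * (\sum_(0 <= s < N.+2) linz_term N s a b c)
    + \sum_(0 <= s < N.+2) step_v s by rewrite eD subrK.
  by rewrite /f; ring.
(* Shift the first sum by one against the second. Its bottom term vanishes by [step_init], and the
   top term s = N + 1 of the second sum vanishes because 2s > N. *)
rewrite big_nat_recl // step_init add0r [X in _ * (_ + X)]big_nat_recr //=.
have -> : y * qint q a * linz_term N.-1 N.+1 a.-1 b c -
     y * qint q b * linz_term N.-1 N.+1 a b.-1 c - step_v N.+1 = 0.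
  rewrite /linz_term /step_v /szego_sub !ifF ?(mulr0, mul0r) ?subr0 //.
  - by apply/negbTE; rewrite -ltnNge; lia.
  - by apply/negbTE; rewrite -ltnNge; lia.
rewrite addr0 -big_split big1 ?mulr0 // => s _.
exact: step_telescope.
Qed.

End Step.

(** * Initial values, and uniqueness of solutions of the relation *)

Lemma linz0n0 b : linz 0 b 0 = (b == 0%N)%:R.
Proof.
rewrite /linz addn0 add0n; case: b => [|b].
  rewrite big_nat1 /linz_term /szego_sub /qfact_inv /= szego0 qfact0.
  by rewrite expr0 invr1 !mulr1.
(* A nonzero term would need both b + 1 <= s and 2s <= b + 1. *)
rewrite big1 ?mulr0 // => s _; rewrite /linz_term /szego_sub /qfact_inv.
case: (leqP b.+1 s) => [lt_bs|_]; last by rewrite mulr0 mul0r mulr0.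
have -> : (2 * s <= b.+1)%N = false by lia.
by rewrite mulr0 mul0r.
Qed.

(* Satisfied by every f with f a b = L(L_a L_b p): both sides are
   L(x L_a L_b p). *)
Definition lag_compat (f : nat -> nat -> F) :=
  forall a b, f a.+1 b + lag_diag a * f a b + y * qint q a ^+ 2 * f a.-1 b =
              f a b.+1 + lag_diag b * f a b + y * qint q b ^+ 2 * f a b.-1.

Lemma lag_compat_uniq f g : lag_compat f -> lag_compat g ->
  (forall b, f 0%N b = g 0%N b) -> forall a b, f a b = g a b.
Proof.
move=> fP gP fg0 a.
(* The relation solves for row a + 1 from rows a and a - 1, so the induction carries two rows; at a
   = 0 they coincide. *)
suff: (forall b, f a b = g a b) /\ (forall b, f a.-1 b = g a.-1 b) by case.
elim: a => [//|a [IH IH1]]; split=> // b.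
move/(canRL (addrK _))/(canRL (addrK _)): (fP a b) => ->.
move/(canRL (addrK _))/(canRL (addrK _)): (gP a b) => ->.
by rewrite !IH !IH1.
Qed.

End QNumbers.

(** * Moments as weighted Motzkin paths *)

Section Scan.

Variables (F : fieldType) (y q : F).
Hypothesis hq : forall j : nat, (0 < j)%N -> q ^+ j != 1.

(* Weighted Motzkin paths of length m from height h to height 0. *)
Fixpoint lag_paths (m h : nat) : F :=
  if m is m'.+1 then
    y * (lag_paths m' h.+1 + qint q h.+1 * lag_paths m' h)
    + qint q h * (lag_paths m' h + qint q h * lag_paths m' h.-1)
  else (h == 0%N)%:R.

Variable n : nat.
Implicit Types (A : {set 'I_n}) (s : 'S_n) (M : rel 'I_n).
Implicit Types (i v w : 'I_n) (kp kv : nat).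

(** The exponents run through 0, ..., |A| - 1. Removing the least element takes away the exponent
    |A| - 1 and leaves the others unchanged. *)
Lemma sum_above A :
  \sum_(v in A) q ^+ #|[set w in A | (v < w)%N]| = qint q #|A|.
Proof.
elim: {A}_.+1 {-2}A (ltnSn #|A|) => // c IH A ltAc.
have [->|[v0 Av0]] := set_0Vmem A; first by rewrite big_set0 cards0 qint0.
have [u /= Au minu] := @arg_minnP _ v0 (mem A) (fun v => v : nat) Av0.
have {}Au : u \in A := Au; have {}minu v : v \in A -> (u <= v)%N by apply: minu.
rewrite (big_setD1 u) //= (cardsD1 u A) Au /= addnC qintD //.
rewrite qint1 // mulr1 addrC -IH; last first.
  by move: ltAc; rewrite (cardsD1 u A) Au.
congr (_ + q ^+ _).
  apply: eq_bigr => v /setD1P[vu Av]; congr (q ^+ _).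
  apply: eq_card => w; rewrite !inE; case: eqP => [->|//].
  by rewrite ltnNge minu // andbF.
apply: eq_card => w; rewrite !inE; case Aw: (w \in A); rewrite ?andbF //=.
by rewrite andbT ltn_neqAle minu // andbT eq_sym.
Qed.

(* M records exactly the arcs (i, s i) inside [0, kp) x [0, kv). *)
Definition scan_class kp kv M : {set 'S_n} :=
  [set s : 'S_n | [forall i : 'I_n, forall v : 'I_n,
     (i < kp)%N && (v < kv)%N ==> ((s i == v) == M i v)]].

(** The candidates for the end of a closing arc. Applied to [flip M], it gives the positions still
    waiting for an image. *)
Definition free_vals kv M : {set 'I_n} :=
  [set v : 'I_n | (v < kv)%N && [forall i : 'I_n, ~~ M i v]].

Definition flip M : rel 'I_n := fun i v => M v i.

Definition add_arc M i v : rel 'I_n :=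
  fun i' v' => M i' v' || (i' == i) && (v' == v).

(** The equality of booleans says at once that [M] is functional and injective. *)
Definition partial_perm kp kv M :=
  (forall i v, M i v -> (i < kp)%N /\ (v < kv)%N)
  /\ (forall i v i' v', M i v -> M i' v' -> (i == i') = (v == v')).

Lemma scan_classP kp kv M s :
  reflect (forall i v, (i < kp)%N -> (v < kv)%N -> (s i == v) = M i v)
          (s \in scan_class kp kv M).
Proof.
rewrite inE; apply: (iffP 'forall_forallP) => sM i v.
  by move=> ip vp; move: (sM i v); rewrite ip vp => /eqP.
by apply/implyP => /andP[ip vp]; rewrite sM.
Qed.

Lemma free_valsP kv M v :
  reflect ((v < kv)%N /\ forall i, M i v = false) (v \in free_vals kv M).
Proof.
rewrite inE; apply: (iffP andP) => [[vkv /forallP Mv]|[vkv Mv]]; split=> //.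
  by move=> i; apply/negbTE.
by apply/forallP => i; rewrite Mv.
Qed.

Lemma partial_perm_flip kp kv M :
  partial_perm kp kv M -> partial_perm kv kp (flip M).
Proof.
move=> [Mb Mi]; split=> [i v /Mb[]//|i v i' v' Miv Miv'].
by rewrite (Mi _ _ _ _ Miv Miv').
Qed.

Lemma partial_perm_widen kp kv kp' kv' M : (kp <= kp')%N -> (kv <= kv')%N ->
  partial_perm kp kv M -> partial_perm kp' kv' M.
Proof.
move=> lep lev [Mb Mi]; split=> // i v /Mb[ip vp].
by split; [exact: leq_trans lep | exact: leq_trans lev].
Qed.

Lemma scan_class_flip kp kv M s :
  (s^-1%g \in scan_class kp kv M) = (s \in scan_class kv kp (flip M)).
Proof.
have e i v : (s^-1%g i == v) = (s v == i).
  by apply/eqP/eqP => <-; rewrite ?permKV ?permK.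
by apply/scan_classP/scan_classP => sM i v ip vp; move: (sM v i vp ip);
  rewrite e.
Qed.

(** * Reading one row or one column *)

Section Row.

Variables (k : 'I_n) (kv : nat) (M : rel 'I_n).
Hypothesis hM : partial_perm k kv M.

Lemma row_empty v : M k v = false.
Proof. by apply/negP => /(proj1 hM)[]; rewrite ltnn. Qed.

Lemma scan_class_none s :
  (s \in scan_class k.+1 kv M) = (s \in scan_class k kv M) && (kv <= s k)%N.
Proof.
apply/scan_classP/andP => [sM|[/scan_classP sM le_kv] i v].
  split; first by apply/scan_classP => i v ik; apply: sM; exact: ltnW.
  by rewrite leqNgt; apply/negP => /(sM _ _ (leqnn _)); rewrite eqxx row_empty.
rewrite ltnS leq_eqVlt => /orP[/eqP/val_inj-> vkv|]; last exact: sM.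
rewrite row_empty; apply: contraTF vkv => /eqP <-.
by rewrite -leqNgt.
Qed.

Lemma scan_class_add s v : v \in free_vals kv M ->
  (s \in scan_class k.+1 kv (add_arc M k v)) =
  [&& s \in scan_class k kv M, (s k < kv)%N & s k == v].
Proof.
move=> /free_valsP[vkv Mv].
apply/scan_classP/and3P => [sM|[/scan_classP sM _ /eqP sk] i w].
  have /eqP sk : s k == v by rewrite sM // /add_arc !eqxx orbT.
  split; rewrite ?sk ?eqxx //.
  apply/scan_classP => i w ik wkv; rewrite (sM i w (ltnW ik) wkv) /add_arc.
  by rewrite -val_eqE (ltn_eqF ik) orbF.
rewrite ltnS leq_eqVlt => /orP[/eqP/val_inj ik wkv|ik wkv].
  by rewrite /add_arc ik row_empty sk eqxx eq_sym.
by rewrite /add_arc sM // -[i == k]val_eqE (ltn_eqF ik) orbF.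
Qed.

Lemma scan_class_free s :
  s \in scan_class k kv M -> (s k < kv)%N -> s k \in free_vals kv M.
Proof.
move=> /scan_classP sM sk; apply/free_valsP; split=> // i.
apply/negP => Mi; have [ik _] := proj1 hM _ _ Mi.
by move: Mi (ik); rewrite -sM // => /eqP/perm_inj->; rewrite ltnn.
Qed.

Lemma partial_perm_add v : v \in free_vals kv M ->
  partial_perm k.+1 kv (add_arc M k v).
Proof.
move=> /free_valsP[vkv Mv]; have [Mb Mi] := hM; split=> [i w|i w i' w'].
  by case/orP=> [/Mb[ik]|/andP[/eqP-> /eqP->]//]; split=> //; exact: ltnW.
case/orP=> [Miw|/andP[/eqP-> /eqP->]];
    case/orP=> [Miw'|/andP[/eqP-> /eqP->]]; rewrite ?eqxx //.
- exact: Mi.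
- have /negbTE-> : i != k by apply: contraTneq Miw => ->; rewrite row_empty.
  by apply/esym/negbTE; apply: contraTneq Miw => ->; rewrite Mv.
- have /negbTE-> : k != i' by apply: contraTneq Miw' => <-; rewrite row_empty.
  by apply/esym/negbTE; apply: contraTneq Miw' => <-; rewrite Mv.
Qed.

Lemma free_vals_add v :
  free_vals kv (add_arc M k v) = free_vals kv M :\ v.
Proof.
apply/setP => w; rewrite in_setD1.
apply/free_valsP/andP => [[wkv Mw]|[wv /free_valsP[wkv Mw]]].
  split; last first.
    by apply/free_valsP; split=> // i; have /norP[/negbTE] := negbT (Mw i).
  by apply/eqP => wv; move: (Mw k); rewrite /add_arc wv !eqxx orbT.
by split=> // i; rewrite /add_arc Mw (negbTE wv) andbF.
Qed.

Lemma free_rows_add v :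
  free_vals k.+1 (flip (add_arc M k v)) = free_vals k (flip M).
Proof.
apply/setP => i; apply/free_valsP/free_valsP => [[ik Mi]|[ik Mi]].
  have Mi' w : M i w = false.
    by move: (Mi w); rewrite /flip /add_arc => /negbT/norP[/negbTE].
  split=> //; rewrite ltn_neqAle -ltnS ik andbT; apply/eqP => /val_inj ek.
  by move: (Mi v); rewrite /flip /add_arc ek !eqxx orbT.
split=> [|w]; first exact: ltnW.
by rewrite /flip /add_arc -[i == k]val_eqE (ltn_eqF ik) orbF; exact: Mi.
Qed.

Lemma free_rows_none :
  free_vals k.+1 (flip M) = k |: free_vals k (flip M).
Proof.
apply/setP => i; rewrite in_setU1.
apply/free_valsP/orP => [[]|[/eqP->|/free_valsP[ik Mi]]].
- rewrite ltnS leq_eqVlt => /orP[/eqP/val_inj->|ik] Mi; first by left.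
  by right; apply/free_valsP.
- by split=> // v; exact: row_empty.
- by split=> //; exact: ltnW.
Qed.

Lemma free_rows_notin : k \notin free_vals k (flip M).
Proof. by apply/free_valsP => -[]; rewrite ltnn. Qed.

(** For kv = k these are the crossings of the second sum of [cr] with i = k. For [s^-1] and kv = k +
    1 they are those of the first sum with s j = k. *)
Definition row_cross s :=
  #|[set v : 'I_n | [&& s k < v, v < kv & k < s^-1%g v]]%N|.

Lemma row_cross_none s : (kv <= s k)%N -> row_cross s = 0%N.
Proof.
move=> le_kv; apply/eqP; rewrite cards_eq0; apply/eqP/setP => v; rewrite !inE.
by apply/and3P => -[skv vkv _]; move: (leq_trans (ltn_trans skv vkv) le_kv);
  rewrite ltnn.
Qed.

(** A value v in (s k, kv) is not the image of k, so its preimage exceeds k exactly when no earlier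
    row took v. The count thus depends only on [M] and s k. *)
Lemma row_cross_add s : s \in scan_class k kv M ->
  row_cross s = #|[set v in free_vals kv M | (s k < v)%N]|.
Proof.
move=> /scan_classP sM; apply: eq_card => v; rewrite !(inE, in_setI).
rewrite -!andbA andbC -andbA; apply: andb_id2l => vkv.
rewrite [RHS]andbC andbC; apply: andb_id2l => skv.
apply/idP/forallP => [ksv i|Mv].
  apply/negP => Miv; have [ik _] := proj1 hM _ _ Miv.
  move: Miv; rewrite -sM // => /eqP siv.
  by move: ksv; rewrite -siv permK ltnNge (ltnW ik).
rewrite ltnNge leq_eqVlt; apply/norP; split.
  apply/eqP => /val_inj ek; move: skv.
  by rewrite -ek permKV ltnn.
apply/negP => ltk; move: (Mv (s^-1%g v)).
by rewrite -sM // permKV eqxx.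
Qed.

(** Either s k >= kv, and row k stays open without crossings, or the permutations are grouped by the
    free value v = s k. *)
Lemma scan_row (f : 'S_n -> F) :
  \sum_(s in scan_class k kv M) q ^+ row_cross s * f s =
  \sum_(s in scan_class k.+1 kv M) f s
  + \sum_(v in free_vals kv M) q ^+ #|[set w in free_vals kv M | (v < w)%N]|
     * \sum_(s in scan_class k.+1 kv (add_arc M k v)) f s.
Proof.
rewrite (bigID (fun s : 'S_n => (kv <= s k)%N)) /=; congr (_ + _).
  under eq_bigl do rewrite -scan_class_none.
  apply: eq_bigr => s; rewrite scan_class_none => /andP[_ /row_cross_none->].
  by rewrite mul1r.
rewrite (partition_big (fun s : 'S_n => s k) (mem (free_vals kv M))) /=.
  apply: eq_bigr => v vM; rewrite mulr_sumr.
  under eq_bigl do rewrite -ltnNge -andbA -(scan_class_add _ vM).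
  apply: eq_bigr => s; rewrite (scan_class_add _ vM) => /and3P[sM _ /eqP <-].
  by rewrite row_cross_add.
by move=> s /andP[sM]; rewrite -ltnNge; exact: scan_class_free.
Qed.

End Row.

(** Transposing the board inverts the permutation, so this is [scan_row] for [flip M]. *)
Lemma scan_col (k : 'I_n) kp M (f : 'S_n -> F) : partial_perm kp k M ->
  \sum_(s in scan_class kp k M) q ^+ row_cross k kp s^-1%g * f s =
  \sum_(s in scan_class kp k.+1 M) f s
  + \sum_(i in free_vals kp (flip M))
     q ^+ #|[set w in free_vals kp (flip M) | (i < w)%N]|
     * \sum_(s in scan_class kp k.+1 (flip (add_arc (flip M) k i))) f s.
Proof.
move=> hM; have := scan_row (partial_perm_flip hM) (fun s => f s^-1%g).
have inv kp' kv' M' (g : 'S_n -> F) :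
    \sum_(s in scan_class kp' kv' (flip M')) g s =
    \sum_(s in scan_class kv' kp' M') g s^-1%g.
  rewrite (reindex_inj invg_inj) /=; apply: eq_bigl => s.
  by rewrite scan_class_flip.
rewrite (inv k kp M) (inv k.+1 kp M).
under eq_bigr do rewrite invgK.
move=> ->; congr (_ + _); first by apply: eq_bigr => s _; rewrite invgK.
apply: eq_bigr => i _; congr (_ * _).
rewrite (inv k.+1 kp (flip (add_arc (flip M) k i))).
by apply: eq_bigr => s _; rewrite invgK.
Qed.

(** Row k is read against the values below k, then column k against the rows up to k. A fixed point
    is therefore open after the row step and gets its factor y there, as [wex] demands. *)
Definition step_weight (k : 'I_n) s : F :=
  y ^+ (k <= s k)%N * q ^+ row_cross k k s * q ^+ row_cross k k.+1 s^-1%g.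

Definition tail_weight k s : F := \prod_(j < n | (k <= j)%N) step_weight j s.

Lemma tail_weightS (k : 'I_n) s :
  tail_weight k s = step_weight k s * tail_weight k.+1 s.
Proof.
rewrite /tail_weight (bigD1 k) //=; congr (_ * _); apply: eq_bigl => j.
by rewrite ltn_neqAle eq_sym andbC.
Qed.

(** With nothing left to read, [M] is the graph of exactly one permutation if no row is open; an
    open row makes the class empty. *)
Lemma scan_class_full h M : partial_perm n n M ->
  #|free_vals n (flip M)| = h -> #|free_vals n M| = h ->
  \sum_(s in scan_class n n M) tail_weight n s = (h == 0%N)%:R.
Proof.
move=> [_ Mi] hp hv.
have w1 s : tail_weight n s = 1.
  by rewrite /tail_weight big1 // => j; rewrite leqNgt ltn_ord.
under eq_bigr do rewrite w1.
have [h0|h_gt0] := posnP h; last first.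
  rewrite big1 // => s /scan_classP sM.
  move: h_gt0; rewrite -hp => /card_gt0P[i /free_valsP[_ Mi0]].
  by move: (sM i (s i) (ltn_ord _) (ltn_ord _)); rewrite eqxx [M _ _]Mi0.
have ex i : exists v, M i v.
  apply/existsP/contraT => /existsPn Mi0.
  have : i \in free_vals n (flip M).
    by apply/free_valsP; split=> // v; apply/negbTE; exact: Mi0.
  by rewrite (cards0_eq (etrans hp h0)) inE.
pose g i := xchoose (ex i).
have Mg i : M i (g i) := xchooseP (ex i).
have g_inj : injective g.
  by move=> i j gij; apply/eqP; rewrite (Mi _ _ _ _ (Mg i) (Mg j)) gij.
rewrite (big_pred1 (perm g_inj)) // => s; apply/scan_classP/eqP => [sM|->].
  apply/permP => i; apply/eqP; rewrite permE.
  by rewrite (sM _ _ (ltn_ord _) (ltn_ord _)) Mg.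
move=> i v _ _; rewrite permE; apply/eqP/idP => [<-//|Miv].
by apply/eqP; rewrite -(Mi _ _ _ _ (Mg i) Miv).
Qed.

(** Column k either stays free, leaving l + 1 open arcs, or takes one of the l + 1 open rows with
    total weight [l+1], leaving l. *)
Lemma scan_col_paths (k : 'I_n) m l M :
  (forall h M', partial_perm k.+1 k.+1 M' ->
     #|free_vals k.+1 (flip M')| = h -> #|free_vals k.+1 M'| = h ->
     \sum_(s in scan_class k.+1 k.+1 M') tail_weight k.+1 s = lag_paths m h) ->
  partial_perm k.+1 k M ->
  #|free_vals k.+1 (flip M)| = l.+1 -> #|free_vals k M| = l ->
  \sum_(s in scan_class k.+1 k M)
     q ^+ row_cross k k.+1 s^-1%g * tail_weight k.+1 s
  = lag_paths m l.+1 + qint q l.+1 * lag_paths m l.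
Proof.
move=> IH hM hp hv; have hM' := partial_perm_flip hM.
rewrite scan_col //; congr (_ + _).
  apply: IH => //; first exact: partial_perm_widen hM.
  by rewrite (free_rows_none hM') cardsU1 (free_rows_notin k (flip M)) hv.
rewrite -hp -sum_above mulr_suml; apply: eq_bigr => i Mi; congr (_ * _).
apply: IH.
- exact/partial_perm_flip/partial_perm_add.
- rewrite (free_vals_add k k.+1 (flip M) i).
  by apply/eq_add_S; rewrite -hp (cardsD1 i (free_vals _ (flip M))) Mi.
- by rewrite free_rows_add.
Qed.

(** Row k stays open with weight y or takes one of the h free values with total weight [h]; the
    column step follows. These two choices are the two factored halves of the recursion of
    [lag_paths]. *)
Lemma scan_paths m k h M : (k + m = n)%N -> partial_perm k k M ->
  #|free_vals k (flip M)| = h -> #|free_vals k M| = h ->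
  \sum_(s in scan_class k k M) tail_weight k s = lag_paths m h.
Proof.
elim: m k h M => [|m IH] k h M kmn hM hp hv.
  by rewrite addn0 in kmn; subst k; exact: scan_class_full.
have ltkn : (k < n)%N by rewrite -kmn addnS ltnS leq_addr.
pose ik := Ordinal ltkn; change k with (ik : nat) in hM, hp, hv |- *.
have {}IH h' M' := IH k.+1 h' M' (etrans (addSnnS k m) kmn).
have hM' := partial_perm_flip hM.
transitivity (\sum_(s in scan_class ik ik M) q ^+ row_cross ik ik s *
    (y ^+ (ik <= s ik)%N * (q ^+ row_cross ik ik.+1 s^-1%g
       * tail_weight ik.+1 s))).
  by apply: eq_bigr => s _; rewrite tail_weightS /step_weight -!mulrA mulrCA.
rewrite scan_row //=; congr (_ + _).
  rewrite -(@scan_col_paths ik m h M) //; first last.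
  - by rewrite (free_rows_none hM) cardsU1 free_rows_notin hp.
  - exact: partial_perm_widen hM.
  rewrite mulr_sumr; apply: eq_bigr => s.
  by rewrite (@scan_class_none ik k M hM) => /andP[_ ->].
(* The completions contribute the same [R] for every choice of v, so the sum over v is [h] times
   [R]. *)
set R := lag_paths m h + _; rewrite -hv -sum_above mulr_suml.
apply: eq_bigr => v vM.
have h_gt0 : (0 < h)%N by rewrite -hv; apply/card_gt0P; exists v.
congr (_ * _).
transitivity (lag_paths m h.-1.+1 + qint q h.-1.+1 * lag_paths m h.-1);
  last by rewrite prednK.
rewrite -(@scan_col_paths ik m h.-1 (add_arc M ik v)) //.
- apply: eq_bigr => s.
  rewrite (@scan_class_add ik k M hM _ _ vM) => /and3P[_ sk _].
  by rewrite leqNgt sk mul1r.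
- exact: partial_perm_add.
- by rewrite (free_rows_add ik) hp prednK.
- by rewrite free_vals_add -hv (cardsD1 v (free_vals ik M)) vM.
Qed.

(** The second sum of [cr] matches term by term through v = s j. The first, over j < i <= s j < s i,
    is regrouped by the value k = s j instead of i. *)
Lemma cr_row_cross s :
  cr s = (\sum_(k < n) (row_cross k k s + row_cross k k.+1 s^-1%g))%N.
Proof.
rewrite big_split /cr [LHS]addnC /=; congr (_ + _)%N.
  apply: eq_bigr => i _; rewrite /row_cross.
  rewrite -[RHS](card_preimset _ (@perm_inj _ s)); apply: eq_card => j.
  by rewrite !inE permK; case: (i < j)%N; rewrite ?andbF //= andbT andbC.
have card_sum (P : pred 'I_n) : #|[set x | P x]| = (\sum_x P x)%N.
  by rewrite -sum1dep_card big_mkcond; apply: eq_bigr => x _; case: (P x).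
rewrite /row_cross; under [LHS]eq_bigr do rewrite card_sum.
under [RHS]eq_bigr do rewrite card_sum.
rewrite [LHS]exchange_big [LHS](reindex_inj (@perm_inj _ s^-1%g)) /=.
apply: eq_bigr => k _; apply: eq_bigr => i _.
by rewrite invgK permKV ltnS.
Qed.

Lemma lag_moment_paths : lag_moment y q n = lag_paths n 0.
Proof.
rewrite -(@scan_paths n 0 0 (fun _ _ => false)) //; first last.
- by apply: eq_card0 => v; rewrite !inE.
- by apply: eq_card0 => v; rewrite !inE.
rewrite /lag_moment; apply: eq_big => s.
  by symmetry; apply/scan_classP.
move=> _; rewrite cr_row_cross /tail_weight /step_weight.
rewrite !big_split /= !prodrXr exprD mulrA.
congr (_ ^+ _ * _ * _); rewrite /wex -sum1dep_card big_mkcond.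
by apply: eq_bigr => i _; case: (i <= s i)%N.
Qed.

End Scan.

(** * The q-Laguerre polynomials, their orthogonality and triple products *)

Section QLaguerre.

Variables (F : fieldType) (y ry q : F).
Hypotheses (h2 : 2%:R != 0 :> F) (hy : ry ^+ 2 = y) (hy0 : y != 0).
Hypothesis hq : forall j : nat, (0 < j)%N -> q ^+ j != 1.

Lemma sqrty_neq0 : ry != 0.
Proof. by apply: contraNneq hy0 => r0; rewrite -hy r0 expr0n. Qed.

Lemma qlaguerre0 : qlaguerre y ry q 0 = 1.
Proof. by rewrite /qlaguerre expr0 scale1r comp_polyC. Qed.

(** The coefficient 1 - q^0 = 0 does the work of the convention for index -1, so [n.-1] is harmless
    at n = 0. *)
Lemma al_salam_chiharaS (a b : F) n :
  al_salam_chihara a b q n.+1 =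
  (2%:R *: 'X - ((a + b) * q ^+ n)%:P) * al_salam_chihara a b q n
  - ((1 - q ^+ n) * (1 - a * b * q ^+ n.-1)) *: al_salam_chihara a b q n.-1.
Proof. by case: n => [|n] //=; rewrite expr0 subrr mul0r scale0r. Qed.

Lemma qlaguerreS n :
  'X * qlaguerre y ry q n =
  qlaguerre y ry q n.+1 + lag_diag y q n *: qlaguerre y ry q n
  + (y * qint q n ^+ 2) *: qlaguerre y ry q n.-1.
Proof.
have hr := sqrty_neq0; have h1 := subq_neq0 hq.
have h1' : q - 1 != 0 by rewrite -oppr_eq0 opprB.
rewrite /qlaguerre al_salam_chiharaS.
set Q := al_salam_chihara _ _ _; set phi := _ *: (_ + _%:P).
rewrite comp_polyB comp_polyM comp_polyB !comp_polyZ comp_polyX comp_polyC.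
set P0 := Q n \Po phi; set P1 := Q n.-1 \Po phi.
set t := ry / (q - 1).
(* The normalization [t] makes 2 t [phi] monic in x, and the constants combine into -(y[n+1] +
   [n]). *)
have eA : t *: (2%:R *: phi - ((1 / ry + ry * q) * q ^+ n)%:P) =
    'X - (lag_diag y q n)%:P.
  rewrite /phi /t scalerBr !scalerA scalerDr scalerA -!mul_polyC -!polyCM.
  have -> : ry / (q - 1) * (2%:R / (2%:R * ry)) * (q - 1) = 1.
    by field; rewrite hr h2 h1'.
  rewrite polyC1 mul1r -addrA -polyCB -polyCN; congr ('X + _%:P).
  rewrite /lag_diag /qint exprS -hy; field.
  by rewrite hr h1 h1' h2.
have ed : t ^+ n.+1 * ((1 - q ^+ n) * (1 - 1 / ry * (ry * q) * q ^+ n.-1)) =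
    y * qint q n ^+ 2 * t ^+ n.-1.
  case: n {eA P0 P1} => [|n] /=; first by rewrite qint0 expr0 subrr; ring.
  by rewrite /t /qint !exprS -hy; field; rewrite hr h1 h1'.
have push (A U V : {poly F}) d : t ^+ n.+1 *: (A * U - d *: V) =
    t ^+ n *: ((t *: A) * U) - (t ^+ n.+1 * d) *: V.
  by rewrite scalerBr scalerA exprSr -scalerAl scalerA.
rewrite push eA ed -!mul_polyC !polyCM.
by ring.
Qed.

(** Both sides obey the three-term recurrence in h and agree at h = 0 by the moment formula. A path
    from height h has h more down steps than up steps; as [lag_paths] puts y on the up steps, y^h
    restores the missing factors. *)
Lemma lag_functional_XnM m h :
  lag_functional y q ('X^m * qlaguerre y ry q h) = y ^+ h * lag_paths y q m h.
Proof.
(* The second conjunct is the predecessor case. Its factor [h] makes it trivial at h = 0 and is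
   available in the recurrence coefficient y[h]^2. *)
suff: (forall m, lag_functional y q ('X^m * qlaguerre y ry q h) =
                 y ^+ h * lag_paths y q m h)
  /\ (forall m, qint q h * lag_functional y q ('X^m * qlaguerre y ry q h.-1) =
                qint q h * (y ^+ h.-1 * lag_paths y q m h.-1)) by case.
elim: h {m} => [|h [IH IH1]].
  split=> m; last by rewrite qint0 !mul0r.
  by rewrite qlaguerre0 mulr1 lag_functionalXn (lag_moment_paths _ hq) mul1r.
split=> m; last by rewrite /= IH.
have -> : 'X^m * qlaguerre y ry q h.+1 =
    'X^(m.+1) * qlaguerre y ry q h
    - lag_diag y q h *: ('X^m * qlaguerre y ry q h)
    - (y * qint q h ^+ 2) *: ('X^m * qlaguerre y ry q h.-1).
  rewrite exprSr -mulrA qlaguerreS !mulrDr -!scalerAr.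
  by rewrite addrAC !addrK.
rewrite !linearB !linearZ /= !IH.
rewrite -(mulrA y) expr2 -(mulrA (qint q h)) IH1 /lag_diag /=.
by case: h {IH IH1} => [|h] /=; rewrite ?qint0 ?exprS; ring.
Qed.

Lemma lag_functional_qlaguerre h :
  lag_functional y q (qlaguerre y ry q h) = (h == 0%N)%:R.
Proof.
rewrite -[qlaguerre _ _ _ _]mul1r -(expr0 'X) lag_functional_XnM /=.
by case: h => [|h]; rewrite ?mulr0 // mul1r.
Qed.

Lemma lag_functional_compat (p : {poly F}) :
  lag_compat y q (fun a b => lag_functional y q
    (qlaguerre y ry q a * qlaguerre y ry q b * p)).
Proof.
move=> a b; rewrite -!linearZ -!linearD /=; congr lag_functional.
set La := qlaguerre y ry q a; set Lb := qlaguerre y ry q b.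
transitivity ('X * La * Lb * p); first by rewrite qlaguerreS !mulrDl -!scalerAl.
rewrite ['X * La]mulrC -(mulrA La 'X) qlaguerreS.
by rewrite !mulrDr !mulrDl -!scalerAr -!scalerAl.
Qed.

Lemma lag_functional_linz n1 n2 n3 :
  lag_functional y q
    (qlaguerre y ry q n1 * qlaguerre y ry q n2 * qlaguerre y ry q n3)
  = linz y q n1 n2 n3.
Proof.
have lin c : lag_compat y q (fun a b => linz y q a b c).
  by move=> a b; exact: linz_rec.
apply: (lag_compat_uniq (lag_functional_compat _) (lin n3)) => {n1 n2} b.
(* With the first index 0, the remaining product is padded by L_0 in the third place. By the
   symmetry of [linz], uniqueness applies again to the other two indices and leaves only the
   functional at a single L_b. *)
rewrite qlaguerre0 mul1r -[_ * _]mulr1 -qlaguerre0.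
rewrite linzCA linzAC.
apply: (lag_compat_uniq (lag_functional_compat _) (lin 0)) => {b n3} b.
by rewrite qlaguerre0 mul1r mulr1 lag_functional_qlaguerre linz0n0.
Qed.

End QLaguerre.

Theorem theorem6 (F : fieldType) (y ry q : F) (n1 n2 n3 : nat)
    (h2 : 2%:R != 0 :> F)
    (hy : ry ^+ 2 = y) (hy0 : y != 0)
    (hq : forall j : nat, (0 < j)%N -> q ^+ j != 1) :
  lag_functional y q
    (qlaguerre y ry q n1 * qlaguerre y ry q n2 * qlaguerre y ry q n3) =
  \sum_(0 <= s < (n1 + n2 + n3).+1 |
          (maxn n1 (maxn n2 n3) <= s)%N && (2 * s <= n1 + n2 + n3)%N)
    (qfact q n1 * qfact q n2 * qfact q n3 * qfact q s * y ^+ s)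
    / (qfact q (n1 + n2 + n3 - 2 * s) * qfact q (s - n3)
       * qfact q (s - n2) * qfact q (s - n1))
    * \sum_(0 <= k < (n1 + n2 + n3 - 2 * s).+1)
        qbinom q (n1 + n2 + n3 - 2 * s) k * y ^+ k
        * q ^+ ('C(k.+1, 2) + 'C(n1 + n2 + n3 - 2 * s - k, 2)).
Proof.
rewrite (lag_functional_linz h2 hy hy0 hq) /linz mulr_sumr [RHS]big_mkcond.
apply: eq_bigr => s _; rewrite !geq_max -!andbA /linz_term /szego_sub.
rewrite (szego_qbinom y hq) /qfact_inv.
(* Each condition on s in the statement matches one zero default of [qfact_inv] or [szego_sub]. *)
do 4?case: leqP => _ /=; rewrite ?(mulr0, mul0r) //.
by field; rewrite !(qfact_neq0 hq).
Qed.
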